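(* Let $(Q,* )$ be a quandle. The space $RCO(Q)$ of right circular orderings on $Q$ is compact, and the space $LCO(Q)$ of left circular orderings on $Q$ is compact.
   Context: A quandle is a non-empty set $Q$ with a binary operation $*$ such that: (1) $s*s=s$ for all $s\in Q$; (2) for any $s_1,s_2\in Q$ there exists a unique $s_3\in Q$ with $s_3*s_2=s_1$; (3) $(s_1*s_2)*s_3=(s_1*s_3)*(s_2*s_3)$ for all $s_1,s_2,s_3\in Q$. A circular ordering on a set $T$ is a map $c:T\times T\times T\to\{-1,0,1\}$ such that: (1) for $(t_1,t_2,t_3)\in T^3$, $c(t_1,t_2,t_3)=0$ if and only if $t_1,t_2,t_3$ are not all distinct (i.e. at least two of them coincide); (2) $c(t_1,t_2,t_3)-c(t_1,t_2,t_4)+c(t_1,t_3,t_4)-c(t_2,t_3,t_4)=0$ for all $t_1,t_2,t_3,t_4\in T$. A left circular ordering on a quandle $Q$ is a circular ordering $c$ on the set $Q$ such that $c(s_1,s_2,s_3)=c(s*s_1,s*s_2,s*s_3)$ for all $s,s_1,s_2,s_3\in Q$. A right circular ordering on $Q$ is a circular ordering $c$ on the set $Q$ such that $c(s_1,s_2,s_3)=c(s_1*s,s_2*s,s_3*s)$ for all $s,s_1,s_2,s_3\in Q$. $LCO(Q)$ and $RCO(Q)$ denote the sets of left, respectively right, circular orderings on $Q$. They carry the subspace topology inherited from $\{-1,0,1\}^{Q^3}$, the set of all maps $Q^3\to\{-1,0,1\}$ with the Tychonoff (product) topology, where $\{-1,0,1\}$ is discrete. *)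

(* Defs.v *)
From mathcomp Require Import all_boot all_order all_algebra.
From mathcomp Require Import all_classical topology.

Set Implicit Arguments.
Unset Strict Implicit.
Unset Printing Implicit Defensive.

Import GRing.Theory.

Local Open Scope classical_set_scope.
Local Open Scope ring_scope.

Record quandle := Quandle {
  quandle_sort :> Type;
  qmul : quandle_sort -> quandle_sort -> quandle_sort;
  quandle_nonempty : inhabited quandle_sort;
  qmul_idem : forall s, qmul s s = s;
  qmul_div : forall s1 s2, exists! s3, qmul s3 s2 = s1;
  qmul_distr : forall s1 s2 s3,
    qmul (qmul s1 s2) s3 = qmul (qmul s1 s3) (qmul s2 s3)
}.

(* The three-element set {-1, 0, 1}, with coercion [ssval] to [int]. *)
Definition sign3 : finType := seq_sub ([:: -1; 0; 1] : seq int).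

(* {-1, 0, 1}^(T^3) with the product topology, each factor being discrete. *)
Definition sign_maps (T : Type) : topologicalType :=
  {ptws T * T * T -> discrete_topology sign3}.

Definition sign_at (T : Type) (c : sign_maps T) (t1 t2 t3 : T) : int :=
  ssval (c (t1, t2, t3)).

Definition circular_ordering (T : Type) (c : sign_maps T) : Prop :=
  (forall t1 t2 t3 : T,
     sign_at c t1 t2 t3 = 0 <-> t1 = t2 \/ t1 = t3 \/ t2 = t3) /\
  (forall t1 t2 t3 t4 : T,
     sign_at c t1 t2 t3 - sign_at c t1 t2 t4
     + sign_at c t1 t3 t4 - sign_at c t2 t3 t4 = 0).

Definition left_circular_ordering (Q : quandle) (c : sign_maps Q) : Prop :=
  circular_ordering c /\
  forall s s1 s2 s3 : Q,
    c (s1, s2, s3) = c (qmul s s1, qmul s s2, qmul s s3).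

Definition right_circular_ordering (Q : quandle) (c : sign_maps Q) : Prop :=
  circular_ordering c /\
  forall s s1 s2 s3 : Q,
    c (s1, s2, s3) = c (qmul s1 s, qmul s2 s, qmul s3 s).

(* The library gives [set_type A], the type of the elements of a set A,
   the initial topology of the inclusion into [sign_maps Q], that is, the
   subspace topology. *)
Definition LCO (Q : quandle) : topologicalType :=
  set_type [set c : sign_maps Q | left_circular_ordering c].

Definition RCO (Q : quandle) : topologicalType :=
  set_type [set c : sign_maps Q | right_circular_ordering c].

Definition compact_space (X : topologicalType) : Prop := compact [set: X].

(* Main.v *)
Require Import Defs.
From mathcomp Require Import all_boot.
From mathcomp Require Import all_classical topology.

Set Implicit Arguments.
Unset Strict Implicit.
Unset Printing Implicit Defensive.

Local Open Scope classical_set_scope.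

(** The space of all sign maps on triples is a product of finite discrete
    spaces, hence compact by Tychonoff's theorem ([sign_maps_compact]).  Each
    instance of an axiom of circular orderings, and each instance of the
    invariance under translations, compares the values of a map at finitely
    many triples.  Since every coordinate is locally constant
    ([near_sign_map_eq]), such an instance passes from a set of maps to its
    closure, so the orderings in question form a closed subset of a compact
    space ([invariant_orderings_compact]).  It remains to move from a compact
    subset to the subspace it carries ([compact_set_type]).

    Left and right orderings are handled together: both are the circular
    orderings invariant under a family of self-maps, namely the left,
    respectively right, translations of the quandle. *)

(** A cluster point of the image filter under the inclusion lies in [A], and
    is a cluster point of the original filter because the neighbourhoods in the
    subspace are traces of neighbourhoods in [X]. *)
Lemma compact_set_type (X : topologicalType) (A : set X) :
  compact A -> compact [set: set_type A].
Proof.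
move=> cA F FF _.
have FA : (set_val @ F) A.
  apply: (@filterS _ F _ setT) => [x _|]; [exact: (set_valP x)|exact: filterT].
have [p [Ap clp]] := cA _ (fmap_proper_filter set_val FF) FA.
exists (exist _ p (mem_set Ap)); split=> // B C FB [_ [[W oW <-] Wp WC]].
have FimB : (set_val @ F) (set_val @` B).
  by apply: (@filterS _ F _ B) => [x Bx|//]; exists x.
have [_ [[b Bb <-] Wb]] := clp _ _ FimB (open_nbhs_nbhs (conj oW Wp)).
by exists b; split=> //; exact: WC.
Qed.

Lemma sign_maps_compact (T : Type) : compact [set: sign_maps T].
Proof.
have c3 : compact [set: discrete_topology sign3].
  by apply: finite_compact; exact: (@finite_finset sign3 setT).
(* Tychonoff's theorem asks for an index type with decidable equality. *)
have := @tychonoff {classic T * T * T}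
  (fun=> discrete_topology sign3) (fun=> setT) (fun=> c3).
by congr compact; apply/seteqP; split.
Qed.

Lemma near_sign_map_eq (T : Type) (c : sign_maps T) (t : T * T * T) :
  \forall c' \near c, c' t = c t.
Proof.
exact: (@proj_continuous {classic T * T * T}
  (fun=> discrete_topology sign3) t c _ (discrete_set1 (c t))).
Qed.

Lemma closed_circular_ordering (T : Type) :
  closed [set c : sign_maps T | circular_ordering c].
Proof.
move=> c clc; split=> [t1 t2 t3|t1 t2 t3 t4].
  have [c' [[c'0 _] e]] := clc _ (near_sign_map_eq c (t1, t2, t3)).
  by rewrite /sign_at -e; exact: c'0.
have [c' [[_ c'cocycle] [[e123 e124] [e134 e234]]]] := clc _ (filterI
  (filterI (near_sign_map_eq c (t1, t2, t3)) (near_sign_map_eq c (t1, t2, t4)))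
  (filterI (near_sign_map_eq c (t1, t3, t4)) (near_sign_map_eq c (t2, t3, t4)))).
by rewrite /sign_at -e123 -e124 -e134 -e234; exact: c'cocycle.
Qed.

Lemma closed_invariant (S T : Type) (f : S -> T -> T) :
  closed [set c : sign_maps T | forall s t1 t2 t3,
    c (t1, t2, t3) = c (f s t1, f s t2, f s t3)].
Proof.
move=> c clc s t1 t2 t3.
have [c' [c'inv [e ef]]] := clc _ (filterI (near_sign_map_eq c (t1, t2, t3))
  (near_sign_map_eq c (f s t1, f s t2, f s t3))).
by rewrite -e -ef; exact: c'inv.
Qed.

Lemma invariant_orderings_compact (S T : Type) (f : S -> T -> T) :
  compact [set c : sign_maps T | circular_ordering c /\
    forall s t1 t2 t3, c (t1, t2, t3) = c (f s t1, f s t2, f s t3)].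
Proof.
apply: subclosed_compact (@sign_maps_compact T) _ => //.
exact: closedI (@closed_circular_ordering T) (closed_invariant (f := f)).
Qed.

Theorem theorem1p1 (Q : quandle) :
  compact_space (RCO Q) /\ compact_space (LCO Q).
Proof.
split; apply: compact_set_type.
- exact: (@invariant_orderings_compact Q Q (fun s t => qmul t s)).
- exact: (@invariant_orderings_compact Q Q (@qmul Q)).
Qed.
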